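(* If there is a proper class ${\sf K}$ of infinite cardinal numbers such that for each $\lambda\in{\sf K}$ there is a cardinal number $f(\lambda)$ such that ${\sf I}(\lambda,f(\lambda))$ holds, then for each cardinal $\lambda\ge 1$ there is a cardinal $\kappa\ge 1$ such that ${\sf B}(\lambda,\kappa)$ is true.
   Context: Ideals: an ideal on a set $S$ is a nonempty family $J\subseteq\mathcal{P}(S)$ closed under subsets and under unions of two members; it is proper if $J\ne\mathcal{P}(S)$ and free if $\bigcup J=S$; $J^+=\mathcal{P}(S)\setminus J$. It is $\lambda^+$-complete if the union of at most $\lambda$ members of $J$ belongs to $J$. For infinite cardinals $\kappa$ and $\lambda$, ${\sf I}(\lambda,\kappa)$ is the statement: there is a free proper ideal $J$ on $\kappa$ such that (1) $J$ is $\lambda^+$-complete; (2) each $X\in J^+$ has a partition into $\lambda$ disjoint sets, each in $J^+$; (3) there is a family $\mathcal{F}\subseteq J^+$ such that (a) for each $X\in J^+$ there exists a $Y\in\mathcal{F}$ with $Y\subseteq X$, and (b) every descending $\omega$-sequence of sets from $\mathcal{F}$ has nonempty intersection. A space is Baire if the intersection of any countable collection of dense open subsets is dense. In the Banach-Mazur game ${\sf BM}(X)$ on a topological space $X$, White chooses a nonempty open $B_0\subseteq X$, Black a nonempty open $B_1\subseteq B_0$, White a nonempty open $B_2\subseteq B_1$, and so on, for $\omega$ innings; White wins if $\bigcap_{n<\omega}B_n=\emptyset$, and Black wins otherwise. A $\pi$-base of $X$ is a family $\mathcal{B}$ of nonempty open subsets of $X$ such that every nonempty open subset of $X$ includes a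 member of $\mathcal{B}$; the $\pi$-weight $\pi(X)$ is the minimal cardinality of a $\pi$-base of $X$. For positive cardinals $\lambda,\kappa$, ${\sf B}(\lambda,\kappa)$ is the statement: if $X$ is a space with $\pi(X)\le\lambda$ and the power $X^{\kappa}$, considered in the box product topology, is Baire, then Black has a winning strategy in ${\sf BM}(X)$. *)

(* Defs.v *)
From HB Require Import structures.
From mathcomp Require Import all_boot.
From mathcomp Require Import all_classical.
From mathcomp Require Import topology.

Set Implicit Arguments.
Unset Strict Implicit.
Unset Printing Implicit Defensive.

Local Open Scope classical_set_scope.
Local Open Scope card_scope.

(* The types of one fixed universe play the role of sets.  A cardinal is
   represented by any type of that cardinality: equality of cardinals is
   [set: A] #= [set: B] and their order is [set: A] #<= [set: B]. *)
Definition cardinal := Type.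

(* This forces the universe of the spaces to be contained in that of the
   cardinals; the box powers below give the converse inclusion. *)
Definition carrier (X : topologicalType) : cardinal := X.

(* A class of cardinals is a set when its members, up to equality of
   cardinals, can be listed by a family indexed by a set. *)
Definition proper_class (C : cardinal -> Prop) :=
  ~ exists (I : cardinal) (F : I -> cardinal),
      forall A : cardinal, C A -> exists i : I, [set: A] #= [set: F i].

Section Ideals.
Variable S : Type.
Implicit Types J : set (set S).

Definition is_ideal J :=
  [/\ J !=set0,
      forall A B, J B -> A `<=` B -> J A &
      forall A B, J A -> J B -> J (A `|` B)].

Definition proper_ideal J := J <> setT.

Definition free_ideal J := \bigcup_(A in J) A = setT.

Definition positive J : set (set S) := ~` J.

(* lambda^+ -completeness, for the cardinal lambda represented by L *)
Definition succ_complete (L : cardinal) J :=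
  forall D : set (set S), D `<=` J -> D #<= [set: L] -> J (\bigcup_(A in D) A).

End Ideals.

(* The principle I(lambda, kappa), which is only meant for infinite lambda
   and kappa; the infinitude is left to the places where it is used. *)
Definition I_principle (L K : cardinal) : Prop :=
  exists J : set (set K),
    [/\ is_ideal J, proper_ideal J & free_ideal J] /\
    [/\ succ_complete L J,
        forall X, positive J X -> exists P : L -> set K,
          partition setT P X /\ (forall i, positive J (P i)) &
        exists F : set (set K),
          [/\ F `<=` positive J,
              forall X, positive J X -> exists2 Y, F Y & Y `<=` X &
              forall Y : nat -> set K,
                (forall n, F (Y n)) -> (forall n, Y n.+1 `<=` Y n) ->
                \bigcap_n Y n !=set0]].

Definition baire_space (X : topologicalType) :=
  forall D : set (set X), countable D -> (forall A, D A -> open A /\ dense A) ->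
    dense (\bigcap_(A in D) A).

Definition pi_base (X : topologicalType) (B : set (set X)) :=
  (forall A, B A -> open A /\ A !=set0) /\
  (forall U : set X, open U -> U !=set0 -> exists2 A, B A & A `<=` U).

(* The least cardinality of a pi-base is at most that of L. *)
Definition pi_weight_le (X : topologicalType) (L : cardinal) :=
  exists2 B : set (set X), pi_base B & B #<= [set: L].

(* The alias is needed because K -> X itself carries the product topology. *)
Definition box_power (K : Type) (X : topologicalType) : Type := K -> X.

Section BoxTopology.
Variables (K : Type) (X : topologicalType).

Definition box (U : K -> set X) : set (box_power K X) :=
  [set f | forall k, U k (f k)].

Definition open_sides : set (K -> set X) := [set U | forall k, open (U k)].

Lemma box_cover : \bigcup_(U in open_sides) box U = setT.
Proof.
by rewrite -subTset => f _; exists (fun=> setT) => // k; exact: openT.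
Qed.

Lemma box_join (U V : K -> set X) (f : box_power K X) :
  open_sides U -> open_sides V -> box U f -> box V f ->
  exists W, [/\ open_sides W, box W f & box W `<=` box U `&` box V].
Proof.
move=> oU oV Uf Vf; exists (fun k => U k `&` V k); split => [k|k|g gUV].
- exact: openI.
- by split; [exact: Uf|exact: Vf].
- by split => k; have [] := gUV k.
Qed.

HB.instance Definition _ := Choice.copy (box_power K X) (K -> X).

HB.instance Definition _ :=
  isBaseTopological.Build (box_power K X) box_cover box_join.

End BoxTopology.

Section BanachMazur.
Variable X : topologicalType.
Implicit Types (B : nat -> set X) (n : nat).

(* B n is a legal move after B 0, ..., B n.-1.  White makes the moves of even
   index and Black those of odd index. *)
Definition BM_legal B n :=
  [/\ open (B n), B n !=set0 & n != 0 -> B n `<=` B n.-1].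

(* A strategy of Black maps the sequence B_0, ..., B_(2n) of the sets played so
   far to B_(2n+1); its values elsewhere are irrelevant. *)
Definition BM_black_strategy (s : seq (set X) -> set X) :=
  forall B n, (forall i, i <= n.*2 -> BM_legal B i) ->
    let A := s (mkseq B n.*2.+1) in [/\ open A, A !=set0 & A `<=` B n.*2].

Definition BM_black_follows (s : seq (set X) -> set X) B :=
  forall n, B n.*2.+1 = s (mkseq B n.*2.+1).

Definition BM_black_winning (s : seq (set X) -> set X) :=
  BM_black_strategy s /\
  forall B, (forall n, BM_legal B n) -> BM_black_follows s B ->
    \bigcap_n B n !=set0.

End BanachMazur.

(* The principle B(lambda, kappa), only meant for positive lambda and kappa *)
Definition B_principle (L K : cardinal) : Prop :=
  forall X : topologicalType,
    pi_weight_le X L -> baire_space (box_power K X) ->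
    exists s : seq (set X) -> set X, BM_black_winning s.

(* Main.v *)
From mathcomp Require Import all_boot.
From mathcomp Require Import all_classical.
From mathcomp Require Import topology.
Require Import Defs.

Set Implicit Arguments.
Unset Strict Implicit.
Unset Printing Implicit Defensive.

Local Open Scope classical_set_scope.
Local Open Scope card_scope.

(** A proper class of cardinals is unbounded, because a family of cardinals
    below L is listed, up to equality, by the subsets of L
    ([proper_class_unbounded], which rests on the comparability of cardinals).
    Since B(lambda, kappa) only becomes stronger as lambda grows, it is enough
    to prove that I(lambda, kappa) implies B(lambda, kappa)
    ([I_principle_B_principle]).

    Suppose that the box power X^kappa is Baire and index a pi-base of X by
    lambda.  White, playing in X^kappa, can play on X all possible games at
    once: he reserves a J-positive region of coordinates for each finite
    sequence s of pi-base elements of the current length, and the moves on that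
    region are those of s, as long as they are legal.  These regions are
    disjoint.  When Black answers in X^kappa by a box with sides in the
    pi-base, completeness of J makes his answer constant on a positive part of
    each region, hence on a member Y of F: this constant is the answer to s.
    White then cuts Y into lambda positive pieces and plays the l-th pi-base
    element on the l-th piece, when it is included in the answer.  This is [position_extend] and [refines_dense].

    Baireness provides a run of this simulation whose boxes have a common point
    f ([baire_chain], the easy half of the Banach-Oxtoby theorem: White has no
    winning strategy in a Baire space).  The answers recorded along this single
    run are a strategy of Black in BM(X).  A play against it follows a branch of
    regions; the members of F chosen along the branch decrease, so they have a
    common point k, and f k belongs to all the sets played
    ([simulation_winning]). *)

(** * Comparability of cardinals *)

Lemma card_leTTP (A B : Type) :
  [set: A] #<= [set: B] <-> exists f : A -> B, injective f.
Proof.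
split=> [/card_leP[f]|[f f_inj]].
  exists (fun x => val (f (to_setT x))) => x y /val_inj /(inj (mem_set I) (mem_set I)).
  by move=> /(congr1 val).
have f_inj_in : {in [set: A] &, injective f} by move=> x y _ _ /f_inj.
by rewrite -(card_le_eql (inj_card_eq f_inj_in)) card_leT.
Qed.

(** The graphs of the injections from a part of A to B *)
Definition partial_injection (A B : Type) (G : set (A * B)) :=
  forall p q, G p -> G q -> (p.1 = q.1) <-> (p.2 = q.2).

(** A maximal partial injection is total or onto: otherwise a pair of unused
    points could be added to its graph. *)
Lemma card_le_total (A B : Type) :
  [set: A] #<= [set: B] \/ [set: B] #<= [set: A].
Proof.
have chains (G : set (set (A * B))) : G `<=` @partial_injection A B ->
    total_on G subset -> partial_injection (\bigcup_(g in G) g).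
  move=> Gpi Gtot p q [g Gg gp] [h Gh hq].
  have [gh|hg] := Gtot _ _ Gg Gh; first by apply: (Gpi _ Gh) => //; exact: gh.
  by apply: (Gpi _ Gg) => //; exact: hg.
have [G [Gpi Gmax]] := Zorn_bigcup chains.
have [domG|/existsNP[a aG]] := pselect (forall a, exists b, G (a, b)).
  left; have [f fG] := choice domG.
  by apply/card_leTTP; exists f => a a' /(Gpi _ _ (fG a) (fG a')).
have [imG|/existsNP[b bG]] := pselect (forall b, exists a, G (a, b)).
  right; have [f fG] := choice imG.
  by apply/card_leTTP; exists f => b b' /(Gpi _ _ (fG b) (fG b')).
case: (Gmax (G `|` [set (a, b)])).
  split; first exact: subsetUl.
  by move=> GE; apply: aG; exists b; apply: GE; right.
move=> [x y] [x' y'] [Gp|->] [Gq|->] //=; first exact: (Gpi _ _ Gp Gq).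
- by split=> E; [case: aG; exists y; rewrite -E|case: bG; exists x; rewrite -E].
- by split=> E; [case: aG; exists y'; rewrite E|case: bG; exists x'; rewrite E].
Qed.

(** If no member of C were at least L, all of them would be at most L, hence
    equal to subsets of L, and the power set of L would list C. *)
Lemma proper_class_unbounded (C : cardinal -> Prop) (L : cardinal) :
  proper_class C -> exists2 M : cardinal, C M & [set: L] #<= [set: M].
Proof.
move=> C_proper; apply: contrapT => bounded; apply: C_proper.
exists (L -> Prop), (fun S : L -> Prop => set_type S) => M CM.
have [LM|] := card_le_total L M; first by case: bounded; exists M.
move=> /card_leTTP[f f_inj]; exists (f @` [set: M]).
apply: card_esym; apply: (card_eq_trans (card_setT _)).
by apply: inj_card_eq => x y _ _ /f_inj.
Qed.

(** * Runs with nonempty intersection in a Baire space *)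

(** If V were disjoint from [O s] for all s in S, then a t in R with [O t]
    included in V could be added to S, against maximality. *)
Lemma maximal_refinement_dense (X : topologicalType) (T : Type)
    (O : T -> set X) (S R : set T) (A V : set X) :
  maximal_disjoint_subcollection O S R ->
  (forall t, O t !=set0) ->
  (forall W, open W -> W !=set0 -> W `<=` A ->
     exists2 t, R t & O t `<=` W) ->
  open V -> V !=set0 -> V `<=` A ->
  exists2 t, S t & V `&` O t !=set0.
Proof.
move=> [SR S_disj S_max] O_ne refine V_open V_ne VA; apply: contrapT => noS.
have [t Rt OtV] := refine V V_open V_ne VA.
have V_disj s x : S s -> V x -> O s x -> False.
  by move=> Ss Vx Osx; apply: noS; exists s => //; exists x.
apply: (S_max (S `|` [set t])).
- split; first exact: subsetUl.
  move=> SE; have [x Otx] := O_ne t.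
  by apply: (V_disj t x) => //; [apply: SE; right|exact: OtV].
- by move=> s [/SR|->].
move=> s s' [Ss|->] [Ss'|->] // [x [Osx Os'x]].
- by apply: S_disj => //; exists x.
- by case: (V_disj s x) => //; exact: OtV.
- by case: (V_disj s' x) => //; exact: OtV.
Qed.

(** Choose a maximal disjoint family of successors of each t.  The iterated
    successors of t0 then form levels whose sets are disjoint and have a dense
    union in [O t0].  A point in all these unions selects exactly one t on each
    level, and disjointness makes every selected t a successor of the previous
    one. *)
Lemma baire_chain (X : topologicalType) (T : Type) (O : T -> set X)
    (R : T -> T -> Prop) (t0 : T) :
  baire_space X -> (forall t, open (O t)) -> (forall t, O t !=set0) ->
  (forall t t', R t t' -> O t' `<=` O t) ->
  (forall t V, open V -> V !=set0 -> V `<=` O t ->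
     exists2 t', R t t' & O t' `<=` V) ->
  exists t : nat -> T, [/\ t 0 = t0, forall n, R (t n) (t n.+1) &
     \bigcap_n O (t n) !=set0].
Proof.
move=> X_baire O_open O_ne R_sub refine.
have [S S_max] : {S : T -> set T &
    forall t, maximal_disjoint_subcollection O (S t) (R t)}.
  exists (fun t => sval (ex_maximal_disjoint_subcollection O (R t))) => t.
  by case: ex_maximal_disjoint_subcollection.
have SR t t' : S t t' -> R t t' by have [+ _ _] := S_max t; exact.
pose level := fix level n : set T :=
  if n is m.+1 then \bigcup_(t in level m) S t else [set t0].
have level_disj n : trivIset (level n) O.
  elim: n => [|n IHn] /=; first by move=> _ _ -> ->.
  move=> s s' [t lt St] [t' lt' St'] [x [Osx Os'x]].
  have tt' : t = t'.
    by apply: IHn => //; exists x; split; apply: R_sub; [exact: SR St|..|exact: SR St'|].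
  by have [_ disj _] := S_max t; apply: disj => //; [rewrite tt'|exists x].
pose D n := \bigcup_(t in level n) O t.
have D_dense n V : open V -> V !=set0 -> V `<=` O t0 -> V `&` D n !=set0.
  elim: n V => [|n IHn] V V_open V_ne VO.
    by have [x Vx] := V_ne; exists x; split => //; exists t0 => //; exact: VO.
  have [x [Vx [t lt Otx]]] := IHn V V_open V_ne VO.
  have [|||s Ss [y [[Vy _] Osy]]] :=
    maximal_refinement_dense (V := V `&` O t) (S_max t) O_ne (@refine t).
  - exact: openI.
  - by exists x.
  - exact: subIsetr.
  by exists y; split => //; exists s => //; exists t.
(* Adding the exterior of O t0 makes D n dense in the whole space. *)
pose E n := D n `|` ~` closure (O t0).
have E_ok A : range E A -> open A /\ dense A.
  move=> [n _ <-]; split.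
    apply: openU; first by apply: bigcup_open => t _.
    by apply: closed_openC; exact: closed_closure.
  move=> U [x Ux] U_open; have [UO|UO] := pselect (U `&` O t0 !=set0).
    have [||y [[Uy _] Dy]] := D_dense n (U `&` O t0) _ UO.
    - exact: openI.
    - exact: subIsetr.
    by exists y; split => //; left.
  exists x; split => //; right => /(_ U) Ocl; apply: UO.
  by rewrite setIC; apply: Ocl; exact: open_nbhs_nbhs.
have E_countable : countable (range E) by exact: card_image_le.
have [x [Ox Ex]] := X_baire _ E_countable E_ok _ (O_ne t0) (O_open t0).
have xD n : exists t, level n t /\ O t x.
  have [[t lt Ot]|] := Ex (E n) (imageP _ I); first by exists t.
  by case; exact: subset_closure.
have [t tP] := choice xD; exists t; split.
- by have [] := tP 0.
- move=> n; have [[t' lt' St'] Ox'] := tP n.+1; have [ltn Otn] := tP n.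
  suff <- : t' = t n by exact: SR.
  by apply: (level_disj n) => //; exists x; split => //; apply: R_sub Ox'; exact: SR.
- by exists x => n _; have [] := tP n.
Qed.

(** * Boxes, pi-bases and positive sets *)

Lemma box_open (K : Type) (X : topologicalType) (U : K -> set X) :
  open_sides U -> open (box U).
Proof.
move=> U_open; exists [set U]; first by move=> _ ->.
by rewrite bigcup_set1.
Qed.

Lemma open_box_sub (K : Type) (X : topologicalType)
    (A : set (box_power K X)) f :
  open A -> A f -> exists U, [/\ open_sides U, box U f & box U `<=` A].
Proof.
move=> [D DO <-] [U DU Uf]; exists U; split => //; first exact: DO.
by move=> g Ug; exists U.
Qed.

(** The indices that code no member of the pi-base stand for the whole space;
    the point x ensures that this is a legal move. *)
Lemma indexed_pi_base (X : topologicalType) (L : Type) (x : X) :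
  pi_weight_le X L ->
  exists base : L -> set X,
    (forall l, open (base l) /\ base l !=set0) /\
    (forall U, open U -> U !=set0 -> exists l, base l `<=` U).
Proof.
move=> [B [B_open B_pi]]; rewrite -(card_le_eql (card_setT B)).
move=> /card_leTTP[code code_inj].
have [l|base baseP] := @choice _ _ (fun (l : L) (W : set X) =>
    (open W /\ W !=set0) /\ forall b : B, code b = l -> W = val b).
  have [[b bl]|no_b] := pselect (exists b, code b = l).
    exists (val b); split; first by apply: B_open; exact: set_valP.
    by move=> b' b'l; congr val; apply: code_inj; rewrite bl b'l.
  exists setT; split; first by split; [exact: openT|exists x].
  by move=> b bl; case: no_b; exists b.
exists base; split=> [l|U U_open U_ne]; first by have [] := baseP l.
have [A BA AU] := B_pi U U_open U_ne.
exists (code (exist _ A (mem_set BA))).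
by have [_ /(_ _ erefl) ->] := baseP (code (exist _ A (mem_set BA))).
Qed.

Section Ideals.
Context (L : cardinal) (K : Type) (J : set (set K)) (J_ideal : is_ideal J).

Lemma positive_nonempty A : positive J A -> A !=set0.
Proof.
move=> A_pos; apply/set0P/eqP => A0; apply: A_pos.
by have [[B JB] + _] := J_ideal; apply; [exact: JB|rewrite A0].
Qed.

Lemma positive_setT : proper_ideal J -> positive J setT.
Proof.
move=> J_proper JT; apply: J_proper; rewrite -subTset => A _.
by have [_ + _] := J_ideal; apply; [exact: JT|].
Qed.

(** A is the union of its fibers under a map to lambda, so by completeness they
    cannot all belong to the ideal. *)
Lemma positive_fiber (col : K -> L) A :
  succ_complete L J -> positive J A ->
  exists l, positive J (A `&` col @^-1` [set l]).
Proof.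
move=> J_complete A_pos; apply: contrapT => null; apply: A_pos.
have -> : A = \bigcup_(B in range (fun l => A `&` col @^-1` [set l])) B.
  rewrite bigcup_image; apply/seteqP; split=> [k Ak|k [l _ []//]].
  by exists (col k).
apply: J_complete; last exact: card_image_le.
by move=> _ [l _ <-]; apply: contrapT => pos; apply: null; exists l.
Qed.

End Ideals.

(** * The moves of White as a sequence of indices *)

Section WhiteCode.
Context (L X : Type) (pick : set X -> L).

(** Latest first, so that a new move is a [cons]; the argument [pick] is meant to
    choose the index of a member of the pi-base included in the move. *)
Definition white_code (B : nat -> set X) n : seq L :=
  rev (mkseq (fun i => pick (B i.*2)) n.+1).

Lemma white_codeS B n :
  white_code B n.+1 = pick (B n.+1.*2) :: white_code B n.
Proof. by rewrite /white_code mkseqS rev_rcons. Qed.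

Lemma eq_white_code B B' n :
  (forall i, i <= n.*2 -> B i = B' i) ->
  white_code B n = white_code B' n.
Proof.
move=> BB'; congr rev; apply/eq_in_map => i; rewrite mem_iota ltnS => /= i_n.
by rewrite BB' // leq_double.
Qed.

Lemma size_white_code B n : size (white_code B n) = n.+1.
Proof. by rewrite size_rev size_mkseq. Qed.

End WhiteCode.

(** * Playing all games on X at once in the box power *)

Section Simulation.
Context (L : cardinal) (K : Type) (X : topologicalType).
Context (J F : set (set K)) (base : L -> set X).
Hypotheses (J_ideal : is_ideal J) (J_proper : proper_ideal J)
  (J_complete : succ_complete L J)
  (J_split : forall A, positive J A -> exists P : L -> set K,
     partition setT P A /\ forall l, positive J (P l))
  (F_pos : F `<=` positive J)
  (F_dense : forall A, positive J A -> exists2 Y, F Y & Y `<=` A)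
  (base_ok : forall l, open (base l) /\ base l !=set0)
  (base_pi : forall U, open U -> U !=set0 -> exists l, base l `<=` U).

(** A situation in the game on X^kappa just after a move [box side] of White.
    The coordinates of [region s] are those reserved for the sequence s of
    moves, latest first.  The side is the same on a whole region, so that one
    answer of Black is legal on all of it. *)
Record position := Position {
  depth : nat;
  side : K -> set X;
  region : seq L -> set K;
  side_ok : forall k, open (side k) /\ side k !=set0;
  region_pos : forall s, size s = depth -> positive J (region s);
  region_disj : trivIset [set s | size s = depth] region;
  side_const : forall s k k', size s = depth ->
    region s k -> region s k' -> side k = side k'
}.

(** The reply of White to [box V], when the coordinates still in use for the
    sequence s are those of Y s: a piece of Y s is reserved for each index l,
    and the move there is [base l], provided that it is legal. *)
Lemma position_extend n (V : K -> set X) (Y : seq L -> set K) :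
  (forall k, open (V k) /\ V k !=set0) ->
  (forall s, size s = n -> positive J (Y s)) ->
  trivIset [set s | size s = n] Y ->
  (forall s k k', size s = n -> Y s k -> Y s k' -> V k = V k') ->
  exists t, [/\ depth t = n.+1, forall k, side t k `<=` V k,
    forall s l, size s = n -> region t (l :: s) `<=` Y s &
    forall s l k, size s = n -> region t (l :: s) k ->
      base l `<=` V k -> side t k = base l].
Proof.
move=> V_ok Y_pos Y_disj V_const.
have [s|P P_ok] := @choice _ _ (fun (s : seq L) (P : L -> set K) => size s = n ->
    partition setT P (Y s) /\ forall l, positive J (P l)).
  have [sn|//] := pselect (size s = n); last by exists (fun=> set0).
  by have [P P_ok] := J_split (Y_pos s sn); exists P.
have P_sub s l : size s = n -> P s l `<=` Y s.
  by move=> /P_ok[[<- _ _] _] k Pk; exists l.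
have P_inj s l s' l' k : size s = n -> size s' = n ->
    P s l k -> P s' l' k -> s = s' /\ l = l'.
  move=> sn s'n Pk P'k.
  have ss' : s = s'.
    apply: Y_disj => //; exists k.
    by split; [exact: (P_sub s l)|exact: (P_sub s' l')].
  split => //; have [[_ + _] _] := P_ok s sn; apply => //.
  by exists k; split => //; rewrite ss'.
pose move_at l k : set X := if `[< base l `<=` V k >] then base l else V k.
have [k|W W_ok] := @choice _ _ (fun (k : K) (W : set X) =>
    [/\ open W /\ W !=set0, W `<=` V k &
     forall s l, size s = n -> P s l k -> W = move_at l k]).
  have [[s [l [sn Pk]]]|no_sl] := pselect (exists s l, size s = n /\ P s l k).
    exists (move_at l k); split.
    - by rewrite /move_at; case: asboolP => _; [exact: base_ok|exact: V_ok].
    - by rewrite /move_at; case: asboolP => // _; exact: subset_refl.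
    - by move=> s' l' s'n P'k; have [_ ->] := P_inj _ _ _ _ _ sn s'n Pk P'k.
  exists (V k); split; [exact: V_ok|exact: subset_refl|] => s l sn Pk.
  by case: no_sl; exists s, l.
pose Z (s : seq L) := if s is l :: s' then P s' l else set0.
have Z_pos s : size s = n.+1 -> positive J (Z s).
  by case: s => // l s [sn]; have [_ /(_ l)] := P_ok s sn.
have Z_disj : trivIset [set s | size s = n.+1] Z.
  move=> [//|l s] [//|l' s'] /= [sn] [s'n] [k [Pk P'k]].
  by have [-> ->] := P_inj _ _ _ _ _ sn s'n Pk P'k.
have W_move s l k : size s = n -> P s l k -> W k = move_at l k.
  by have [_ _] := W_ok k; apply.
have W_const s k k' : size s = n.+1 -> Z s k -> Z s k' -> W k = W k'.
  case: s => // l s [sn] Pk Pk'.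
  rewrite (W_move s l k) // (W_move s l k') // /move_at (V_const s k k') //.
  - exact: (P_sub s l).
  - exact: (P_sub s l).
have W_ne k : open (W k) /\ W k !=set0 by have [] := W_ok k.
exists (Position W_ne Z_pos Z_disj W_const); split => //=.
- by move=> k; have [] := W_ok k.
- by move=> s l k sn Pk lV; rewrite (W_move s l k) // /move_at asboolT.
Qed.

(** The set [a.1] is where Black's answer to the moves s has the index [a.2].
    It must be in F for the sets obtained along a play to have a common point,
    and it must contain the next regions for these sets to decrease. *)
Definition answers (t : position) (s : seq L) (a : set K * L) (t' : position) :=
  [/\ F a.1, a.1 `<=` region t s,
    forall k, a.1 k -> base a.2 `<=` side t k,
    forall l, region t' (l :: s) `<=` a.1 &
    forall l k, base l `<=` base a.2 -> region t' (l :: s) k ->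
      side t' k = base l].

Definition refines (t t' : position) :=
  [/\ depth t' = (depth t).+1, forall k, side t' k `<=` side t k &
    forall s, size s = depth t -> exists a, answers t s a t'].

(** Whatever Black plays, White can continue the simulation inside it: Black's
    set is shrunk to a box with sides in the pi-base, and the index of the side
    is constant on a positive part of each region. *)
Lemma refines_dense t (A : set (box_power K X)) :
  open A -> A !=set0 -> A `<=` box (side t) ->
  exists2 t', refines t t' & box (side t') `<=` A.
Proof.
move=> A_open [f Af] At; have [U [U_open Uf UA]] := open_box_sub A_open Af.
have [k|col col_U] := @choice _ _ (fun k l => base l `<=` U k).
  by apply: base_pi; [exact: U_open|exists (f k); exact: Uf].
(* Inclusion of boxes with nonempty sides is inclusion of the sides: vary one
   coordinate of a point of the smaller box. *)
have [pt pt_base] := choice (fun l => (base_ok l).2).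
have col_side k : base (col k) `<=` side t k.
  move=> x colx.
  pose g : box_power K X := fun j => if `[< j = k >] then x else pt (col j).
  have /At/(_ k) : A g.
    by apply: UA => j; rewrite /g; case: asboolP => [->|_]; apply: col_U.
  by rewrite /g asboolT.
have [k0 _] := positive_nonempty J_ideal (positive_setT J_ideal J_proper).
have [s|a a_ok] := @choice _ _ (fun (s : seq L) (a : set K * L) =>
    size s = depth t -> [/\ F a.1, a.1 `<=` region t s &
      forall k, a.1 k -> col k = a.2]).
  have [st|] := pselect (size s = depth t); last by exists (set0, col k0).
  have [l Zl_pos] := positive_fiber col J_complete (region_pos st).
  have [Y FY YZ] := F_dense Zl_pos.
  by exists (Y, l); split => //= k /YZ[].
have [||||t' [depth_t' side_t' region_t' base_t']] :=
    @position_extend (depth t) (base \o col) (fun s => (a s).1).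
- by move=> k; exact: base_ok.
- by move=> s /a_ok[/F_pos].
- move=> s s' st s't [k [sk s'k]]; apply: (region_disj st s't).
  have [_ sub _] := a_ok s st; have [_ sub' _] := a_ok s' s't.
  by exists k; split; [exact: sub|exact: sub'].
- by move=> s k k' /a_ok[_ _ cola] /cola /= -> /cola ->.
exists t'; last by move=> g gt'; apply: UA => k; apply: col_U; exact: side_t'.
split=> // [k|s st]; first exact: subset_trans (side_t' k) (col_side k).
have [Fa aZ cola] := a_ok s st; exists (a s); split => //.
- by move=> k /cola <-.
- by move=> l; exact: region_t'.
- move=> l k la tk; apply: (base_t' _ _ _ st tk) => /=.
  by rewrite (cola k) //; exact: region_t' tk.
Qed.

(** White's first move plays every member of the pi-base on a positive set of
    coordinates. *)
Lemma first_position (x : X) :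
  exists t, depth t = 1 /\
    forall l k, region t [:: l] k -> side t k = base l.
Proof.
have [||||t [depth_t _ _ base_t]] :=
    @position_extend 0 (fun=> setT) (fun=> setT).
- by move=> k; split; [exact: openT|exists x].
- by move=> s _; exact: positive_setT.
- by move=> [|//] [|//].
- by [].
by exists t; split => // l k tk; exact: (base_t [::]).
Qed.

Lemma simulation_run (x : X) : baire_space (box_power K X) ->
  exists (t : nat -> position) (a : nat -> seq L -> set K * L) (f : K -> X),
    [/\ forall l k, region (t 0) [:: l] k -> side (t 0) k = base l,
      forall n s, size s = n.+1 -> answers (t n) s (a n s) (t n.+1) &
      forall n k, side (t n) k (f k)].
Proof.
move=> X_baire; have [t0 [depth_t0 base_t0]] := first_position x.
have [||||t [t_0 t_S [f tf]]] :=
    @baire_chain _ position (fun t => box (side t)) refines t0 X_baire.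
- by move=> t; apply: box_open => k; have [] := side_ok t k.
- move=> t; have [f tf] := choice (fun k => (side_ok t k).2).
  by exists f.
- by move=> t t' [_ sub _] f t'f k; exact: sub.
- exact: refines_dense.
have depth_t n : depth (t n) = n.+1.
  by elim: n => [|n IHn]; [rewrite t_0|have [-> _ _] := t_S n; rewrite IHn].
have [k0 _] := positive_nonempty J_ideal (positive_setT J_ideal J_proper).
have [l0 _] := base_pi openT (ex_intro _ x I).
have [[n s]|a a_ok] := @choice _ _ (fun (p : nat * seq L) (a : set K * L) =>
    size p.2 = p.1.+1 -> answers (t p.1) p.2 a (t p.1.+1)).
  have [sn|] := pselect (size s = n.+1); last by exists (set0, l0).
  have [_ _ /(_ s)[|a ta]] := t_S n; first by rewrite depth_t.
  by exists a.
exists t, (fun n s => a (n, s)), f; split => [l k|n s sn|n k].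
- by rewrite t_0; exact: base_t0.
- exact: (a_ok (n, s)).
- exact: (tf n I).
Qed.

(** Black reads White's moves as indices in the pi-base and copies the answer
    recorded in the simulation; the guard in the strategy makes it legal
    after moves of Black that do not follow it.  Along a play that follows it,
    the guard never interferes ([reply_B]). *)
Lemma simulation_winning (x : X)
    (F_meet : forall Y : nat -> set K,
       (forall n, F (Y n)) -> (forall n, Y n.+1 `<=` Y n) ->
       \bigcap_n Y n !=set0) :
  baire_space (box_power K X) ->
  exists s : seq (set X) -> set X, BM_black_winning s.
Proof.
move=> X_baire.
have [t [a [f [t_0 t_a tf]]]] := simulation_run x X_baire.
have [U|pick pickP] := @choice _ _ (fun (U : set X) l =>
    open U -> U !=set0 -> base l `<=` U).
  have [[oU Un]|noU] := pselect (open U /\ U !=set0).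
    by have [l lU] := base_pi oU Un; exists l.
  have [l _] := base_pi openT (ex_intro _ x I).
  by exists l => oU Un; case: noU.
pose reply n c := base (a n c).2.
pose s (h : seq (set X)) :=
  let R := reply (size h)./2 (white_code pick (nth set0 h) (size h)./2) in
  if `[< R `<=` last set0 h >] then R else last set0 h.
have s_eq B n : s (mkseq B n.*2.+1) =
    if `[< reply n (white_code pick B n) `<=` B n.*2 >]
    then reply n (white_code pick B n) else B n.*2.
  rewrite /s size_mkseq (half_bit_double n true) mkseqS last_rcons -mkseqS.
  rewrite (@eq_white_code _ _ pick _ B) // => i i_n.
  by rewrite nth_mkseq.
exists s; split=> [B n B_legal|B B_legal B_follows].
  rewrite s_eq /=; case: asboolP => [sub|_].
    by have [] := base_ok (a n (white_code pick B n)).2.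
  by have [B_open B_ne _] := B_legal _ (leqnn n.*2); split.
pose c := white_code pick B; pose Y n := (a n (c n)).1.
have ans n : answers (t n) (c n) (a n (c n)) (t n.+1).
  by apply: t_a; rewrite size_white_code.
have Y_ne n : Y n !=set0.
  by apply: (positive_nonempty J_ideal); apply: F_pos; have [] := ans n.
have pickB n : base (pick (B n)) `<=` B n.
  by apply: pickP; have [] := B_legal n.
have B_sub n : B n.+1 `<=` B n by have [_ _] := B_legal n.+1; exact.
(* On the region of the play, White's simulated move is the one actually
   encoded: it is legal there because Black's simulated and actual answers
   coincide. *)
have side_B n : forall k, region (t n) (c n) k -> side (t n) k = base (pick (B n.*2)).
  elim: n => [|n IHn] k; first exact: t_0.
  have [_ aZ a_side a_region a_base] := ans n.
  have [j Yj] := Y_ne n.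
  have reply_B : reply n (c n) `<=` B n.*2.
    apply: subset_trans (pickB n.*2); rewrite -(IHn j); last exact: aZ.
    exact: a_side.
  have B_reply : B n.*2.+1 = reply n (c n).
    by rewrite B_follows s_eq asboolT.
  rewrite /c white_codeS; apply: a_base.
  by rewrite -/(reply n (c n)) -B_reply; apply: subset_trans (B_sub _); exact: pickB.
have [||k Yk] := F_meet Y.
- by move=> n; have [] := ans n.
- move=> n; have [_ aZ _ _ _] := ans n.+1; have [_ _ _ a_region _] := ans n.
  by apply: subset_trans aZ _; rewrite /c white_codeS; exact: a_region.
have fB n : B n.*2 (f k).
  apply: pickB; rewrite -(side_B n k); first exact: tf.
  by have [_ aZ _ _ _] := ans n; apply: aZ; exact: Yk.
have B_mono m n : B (m + n) `<=` B m.
  elim: n => [|n IHn]; first by rewrite addn0.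
  by rewrite addnS; apply: subset_trans IHn.
by exists (f k) => n _; apply: (B_mono n n); rewrite addnn.
Qed.

End Simulation.

(** * From I(lambda, kappa) to B(lambda, kappa) *)

Lemma empty_winning (X : topologicalType) :
  [set: X] = set0 -> exists s : seq (set X) -> set X, BM_black_winning s.
Proof.
move=> X0; have no_move (U : set X) : U !=set0 -> False.
  by move=> [x _]; have : [set: X] x by []; rewrite X0.
exists (fun=> set0); split=> [B n B_legal|B B_legal _].
  by have [_ /no_move] := B_legal 0 isT.
by have [_ /no_move] := B_legal 0.
Qed.

Lemma I_principle_B_principle (L K : cardinal) :
  I_principle L K -> B_principle L K.
Proof.
move=> [J [[J_ideal J_proper _] [J_complete J_split]]].
move=> [F [F_pos F_dense F_meet]] X X_pi X_baire.
have [X0|/set0P[x _]] := eqVneq [set: X] set0; first exact: empty_winning.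
have [base [base_ok base_pi]] := indexed_pi_base x X_pi.
exact: (simulation_winning J_ideal J_proper J_complete J_split F_pos F_dense
  base_ok base_pi x F_meet X_baire).
Qed.

Theorem corollary25 (C : cardinal -> Prop)
  (C_proper : proper_class C)
  (C_infinite : forall L : cardinal, C L -> infinite_set [set: L])
  (C_I : forall L : cardinal, C L ->
     exists K : cardinal, infinite_set [set: K] /\ I_principle L K) :
  forall L : cardinal, [set: L] !=set0 ->
  exists K : cardinal, [set: K] !=set0 /\ B_principle L K.
Proof.
move=> L _; have [M CM LM] := proper_class_unbounded L C_proper.
have [K [K_inf MK]] := C_I M CM; exists K; split.
  by apply/set0P/eqP => K0; apply: K_inf; rewrite K0; exact: finite_set0.
move=> X [B B_pi BL]; apply: (I_principle_B_principle MK).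
by exists B => //; exact: card_le_trans LM.
Qed.
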